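(* For a weak $f$-K-contact manifold $M^{2n+s}(f,Q,\xi_i,\eta^i,g)$ we have, for all $i,j\in\{1,\dots,s\}$ and all vector fields $X$: $$R_{\xi_i,X}=\nabla_Xf,$$ $$R_{X,\xi_i}\,\xi_j=-f^2X,$$ $$\operatorname{Ric}^\sharp\xi_i=\operatorname{div}f,$$ $$\operatorname{Ric}(\xi_i,\xi_j)=\operatorname{trace}Q=2n+\operatorname{trace}\widetilde Q.$$
   Context: Let $n,s\ge1$ and let $M=M^{2n+s}$ be a smooth manifold of dimension $2n+s$. A weak metric $f$-structure on $M$ is a set $(f,Q,\xi_i,\eta^i,g)$ $(i=1,\dots,s)$, where $f$ is a $(1,1)$-tensor, $Q$ is a nonsingular $(1,1)$-tensor, $\xi_i$ are vector fields (the characteristic vector fields), $\eta^i$ are 1-forms and $g$ is a Riemannian metric, such that $$f^2=-Q+\sum_i\eta^i\otimes\xi_i,\quad \eta^i(\xi_j)=\delta^i_j,\quad Q\,\xi_i=\xi_i,$$ the $2n$-dimensional distribution $\mathcal D:=\bigcap_i\ker\eta^i$ is $f$-invariant ($fX\in\mathcal D$ for $X\in\mathcal D$), and $g(fX,fY)=g(X,QY)-\sum_i\eta^i(X)\,\eta^i(Y)$ for all vector fields $X,Y$. Put $\Phi(X,Y)=g(X,fY)$. The exterior derivative of a 1-form is normalized by $d\eta(X,Y)=\frac12\{X(\eta(Y))-Y(\eta(X))-\eta([X,Y])\}$. The structure is weak $f$-contact if $\Phi=d\eta^1=\dots=d\eta^s$; a weak $f$-contact structure is weak $f$-K-contact if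 all $\xi_i$ are Killing for $g$. $R_{X,Y}Z=(\nabla_X\nabla_Y-\nabla_Y\nabla_X-\nabla_{[X,Y]})Z$ is the curvature tensor of the Levi-Civita connection $\nabla$, $\operatorname{Ric}(Y,Z)=\operatorname{trace}(X\mapsto R_{X,Y}Z)$, and $\operatorname{Ric}^\sharp$ is defined by $\operatorname{Ric}(X,Y)=g(\operatorname{Ric}^\sharp X,Y)$. $\operatorname{div}f=\sum_k(\nabla_{e_k}f)e_k$ for a local orthonormal frame $(e_k)$ of $TM$. $\widetilde Q=Q-\mathrm{id}_{TM}$. The trace of $Q$ is taken over $\mathcal D$: $\operatorname{trace}Q=\sum_{k=1}^{2n}g(Qe_k,e_k)$ for a local orthonormal frame $(e_k)$ of $\mathcal D$. *)

(* Defs.v *)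
From HB Require Import structures.
From mathcomp Require Import all_boot all_order all_algebra.
From mathcomp Require Import ring.
From mathcomp Require Import all_classical all_reals all_analysis.
Import Order.TTheory GRing.Theory Num.Theory.
Import numFieldNormedType.Exports.

Set Implicit Arguments.
Unset Strict Implicit.
Unset Printing Implicit Defensive.

Local Open Scope classical_set_scope.
Local Open Scope ring_scope.

Section SmoothOn.
Context {R : realType} {m : nat}.
Implicit Types (U : set 'rV[R]_m) (u v : 'rV[R]_m -> R).

(* All partial derivatives of order at most k exist and are continuous on the
   open set U. *)
Fixpoint Ck (k : nat) U u : Prop :=
  (forall x, U x -> {for x, continuous u}) /\
  if k is k'.+1 then
    forall j : 'I_m, (forall x, U x -> derivable u x (delta_mx 0 j)) /\
                     Ck k' U ('D_(delta_mx 0 j) u)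
  else True.

Definition smooth_on U u : Prop := open U /\ forall k, Ck k U u.

Lemma Ck_continuous k U u : Ck k U u -> forall x, U x -> {for x, continuous u}.
Proof. by case: k => [|k] []. Qed.

Lemma Ck_le k U u : Ck k.+1 U u -> Ck k U u.
Proof.
elim: k u => [|k IH] u /=; first by case.
move=> [cu du]; split=> // j; have [d1 d2] := du j.
by split=> //; exact: IH.
Qed.

Lemma open_near_eq U u v x : open U -> (forall x, U x -> u x = v x) -> U x ->
  \forall y \near x, u y = v y.
Proof. by move=> oU uv Ux; apply: filterS uv _; exact: open_nbhs_nbhs. Qed.

Lemma Ck_eq k U u v : open U -> (forall x, U x -> u x = v x) ->
  Ck k U u -> Ck k U v.
Proof.
move=> oU; elim: k u v => [|k IH] u v uv Cu; split=> //; try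
  by move=> x Ux; rewrite /prop_for /continuous_at -(uv _ Ux);
  exact: cvg_trans (near_eq_cvg (open_near_eq oU uv Ux)) (Ck_continuous Cu Ux).
move=> j; have [d1 d2] := Cu.2 j; split=> [x Ux|].
  exact: near_eq_derivable (open_near_eq oU uv Ux) (d1 x Ux).
apply: IH d2 => x Ux; exact: near_eq_derive (open_near_eq oU uv Ux).
Qed.

Lemma Ck_cst k U (a : R) : open U -> Ck k U (cst a).
Proof.
move=> oU; elim: k a => [|k IH] a /=.
  by split=> // x _; exact: cst_continuous.
split=> [x _|j]; first exact: cst_continuous.
split=> [x _|]; first exact: derivable_cst.
by apply: Ck_eq (IH 0) => // x _; rewrite derive_cst.
Qed.

Lemma Ck_add k U u v : open U -> Ck k U u -> Ck k U v -> Ck k U (u + v).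
Proof.
move=> oU; elim: k u v => [|k IH] u v /= [cu du] [cv dv].
  by split=> // x Ux; apply: continuousD; [exact: cu|exact: cv].
split=> [x Ux|j]; first by apply: continuousD; [exact: cu|exact: cv].
have [du1 du2] := du j; have [dv1 dv2] := dv j; split=> [x Ux|].
  by apply: derivableD; [exact: du1|exact: dv1].
apply: Ck_eq (IH _ _ du2 dv2) => // x Ux.
by rewrite deriveD //; [exact: du1|exact: dv1].
Qed.

Lemma Ck_mul k U u v : open U -> Ck k U u -> Ck k U v -> Ck k U (u * v).
Proof.
move=> oU; elim: k u v => [|k IH] u v Cu Cv.
  split=> // x Ux; apply: continuousM; [exact: Cu.1|exact: Cv.1].
have [cu du] := Cu; have [cv dv] := Cv.
split=> [x Ux|j]; first by apply: continuousM; [exact: cu|exact: cv].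
have [du1 du2] := du j; have [dv1 dv2] := dv j; split=> [x Ux|].
  by apply: derivableM; [exact: du1|exact: dv1].
have H1 := IH _ _ (Ck_le Cu) dv2; have H2 := IH _ _ (Ck_le Cv) du2.
apply: Ck_eq (Ck_add oU H1 H2) => // x Ux.
by rewrite deriveM //; [exact: du1|exact: dv1].
Qed.

End SmoothOn.

Record chart (R : realType) (m : nat) (T : topologicalType) := Chart {
  cdom : set T;
  cmap : T -> 'rV[R]_m;
  cinv : 'rV[R]_m -> T;
  cdom_open : open cdom;
  cimg_open : open (cmap @` cdom);
  cmapK : forall p, cdom p -> cinv (cmap p) = p;
  cmap_continuous : forall p, cdom p -> {for p, continuous cmap};
  cinv_continuous : forall x, (cmap @` cdom) x -> {for x, continuous cinv}
}.

Record manifold (R : realType) (m : nat) := Manifold {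
  carrier :> topologicalType;
  atlas : set (chart R m carrier);
  manifold_hausdorff : hausdorff_space carrier;
  manifold_countable : @second_countable carrier;
  atlas_cover : forall p : carrier, exists2 c, atlas c & cdom c p;
  atlas_compatible : forall c c', atlas c -> atlas c' ->
    forall j : 'I_m, smooth_on (cmap c @` (cdom c `&` cdom c'))
                               (fun x => cmap c' (cinv c x) 0 j)
}.

Section SmoothFunctions.
Context {R : realType} {m : nat}.
Variable M : manifold R m.

Definition smooth (h : M -> R) : Prop :=
  forall c, @atlas R m M c -> smooth_on (cmap c @` cdom c) (h \o cinv c).

Definition smooth_pred : {pred M -> R} := [pred h | `[< smooth h >]].

Lemma smooth_subring : subring_closed smooth_pred.
Proof.
split=> [|h k|h k].
- apply/asboolP => c _; split=> [|k]; first exact: cimg_open.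
  by apply: (Ck_cst k 1); exact: cimg_open.
- move=> /asboolP hs /asboolP ks; apply/asboolP => c ac.
  split=> [|l]; first exact: cimg_open.
  have [oU H] := hs c ac; have [_ K] := ks c ac.
  apply: Ck_eq (Ck_add oU (H l) (Ck_mul oU (Ck_cst l (-1) oU) (K l))) => // x _.
  by rewrite -[LHS]/(_ + -1 * _) mulN1r.
- move=> /asboolP hs /asboolP ks; apply/asboolP => c ac.
  have [oU H] := hs c ac; have [_ K] := ks c ac.
  by split=> // l; exact: Ck_mul.
Qed.
HB.instance Definition _ :=
  GRing.isSubringClosed.Build (M -> R) smooth_pred smooth_subring.

Lemma smooth_scaled : GRing.scaler_closed smooth_pred.
Proof.
move=> a h /asboolP hs; apply/asboolP => c ac.
have [oU H] := hs c ac; split=> // l.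
exact: Ck_mul (Ck_cst l a oU) (H l).
Qed.
HB.instance Definition _ :=
  GRing.isScaleClosed.Build R (M -> R) smooth_pred smooth_scaled.

Record Cinf := MkCinf { cfun :> M -> R; _ : cfun \in smooth_pred }.
HB.instance Definition _ := [isSub for cfun].
HB.instance Definition _ := [Choice of Cinf by <:].
HB.instance Definition _ := 
  GRing.SubChoice_isSubComPzRing.Build (M -> R) smooth_pred Cinf smooth_subring.
HB.instance Definition _ := [SubZmodule_isSubLmodule of Cinf by <:].

Lemma Cinf_smooth (h : Cinf) : smooth h.
Proof. by case: h => h /= /asboolP. Qed.

Definition toCinf (h : M -> R) (hs : smooth h) : Cinf := MkCinf (asboolT hs).

(* T_p M is the space of derivations at p of the algebra of smooth functions;
   a smooth vector field maps smooth functions to smooth functions. *)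
Definition derivation_at (p : M) (v : Cinf -> R) : Prop :=
  [/\ forall h k, v (h + k) = v h + v k,
      forall (a : R) h, v (a *: h) = a * v h &
      forall h k, v (h * k) = h p * v k + k p * v h].

Definition derivation_pred (p : M) : {pred Cinf -> R} :=
  [pred v | `[< derivation_at p v >]].

Lemma derivation_submod p : submod_closed (derivation_pred p).
Proof.
split=> [|a v w].
  by apply/asboolP; split=> *; rewrite /= ?mulr0 ?addr0.
move=> /asboolP[vD vZ vM] /asboolP[wD wZ wM]; apply/asboolP; split=> [h k|b h|h k].
- have E (l : Cinf) : (a *: v + w) l = a * v l + w l by [].
  by rewrite !E vD wD mulrDr addrACA.
- have E (l : Cinf) : (a *: v + w) l = a * v l + w l by [].
  by rewrite !E vZ wZ mulrCA -mulrDr.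
- have E (l : Cinf) : (a *: v + w) l = a * v l + w l by [].
  by rewrite !E vM wM !mulrDr addrACA (mulrCA a (h p)) (mulrCA a (k p)).
Qed.
HB.instance Definition _ p := GRing.isSubmodClosed.Build R (Cinf -> R)
  (derivation_pred p) (derivation_submod p).

Record tangent (p : M) :=
  MkTangent { tapp :> Cinf -> R; _ : tapp \in derivation_pred p }.
HB.instance Definition _ p := [isSub for @tapp p].
HB.instance Definition _ p := [Choice of tangent p by <:].
HB.instance Definition _ p := [SubChoice_isSubLmodule of tangent p by <:].

Lemma tangent_derivation p (v : tangent p) : derivation_at p v.
Proof. by case: v => v /= /asboolP. Qed.

Record vfield := MkVfield {
  vat :> forall p, tangent p;
  vat_smooth : forall h : Cinf, smooth (fun p => vat p h)
}.

Definition vapp (X : vfield) (h : Cinf) : Cinf := toCinf (vat_smooth X h).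

Lemma CinfD_smooth (h k : Cinf) : smooth (fun p => h p + k p).
Proof. exact: (Cinf_smooth (h + k)). Qed.
Lemma CinfB_smooth (h k : Cinf) : smooth (fun p => h p - k p).
Proof. exact: (Cinf_smooth (h - k)). Qed.
Lemma CinfM_smooth (h k : Cinf) : smooth (fun p => h p * k p).
Proof. exact: (Cinf_smooth (h * k)). Qed.

Lemma vadd_smooth (X Y : vfield) h : smooth (fun p => (X p + Y p) h).
Proof. exact: (CinfD_smooth (vapp X h) (vapp Y h)). Qed.
Definition vadd (X Y : vfield) : vfield := MkVfield (vadd_smooth X Y).

Lemma vmul_smooth (k : Cinf) (X : vfield) h : smooth (fun p => (k p *: X p) h).
Proof. exact: (CinfM_smooth k (vapp X h)). Qed.
Definition vmul (k : Cinf) (X : vfield) : vfield := MkVfield (vmul_smooth k X).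

Lemma bracket_derivation (X Y : vfield) (p : M) :
  (fun h => X p (vapp Y h) - Y p (vapp X h)) \in derivation_pred p.
Proof.
have vD (Z : vfield) h k : vapp Z (h + k) = vapp Z h + vapp Z k.
  apply/val_inj/funext => q /=.
  by have [-> _ _] := tangent_derivation (Z q).
have vZ (Z : vfield) (a : R) h : vapp Z (a *: h) = a *: vapp Z h.
  apply/val_inj/funext => q /=.
  by have [_ -> _] := tangent_derivation (Z q).
have vM (Z : vfield) h k : vapp Z (h * k) = h * vapp Z k + k * vapp Z h.
  apply/val_inj/funext => q /=.
  by have [_ _ ->] := tangent_derivation (Z q).
have [XD XZ XM] := tangent_derivation (X p).
have [YD YZ YM] := tangent_derivation (Y p).
apply/asboolP; split=> [h k|a h|h k].
- by rewrite !vD XD YD opprD addrACA.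
- by rewrite !vZ XZ YZ mulrBr.
- rewrite !vM XD YD !XM !YM /=.
  set a := X p (vapp Y k); set b := X p (vapp Y h).
  set c := Y p (vapp X k); set d := Y p (vapp X h).
  by rewrite /a /b /c /d; ring.
Qed.

Lemma bracket_smooth (X Y : vfield) h :
  smooth (fun p => MkTangent (bracket_derivation X Y p) h).
Proof. exact: (CinfB_smooth (vapp X (vapp Y h)) (vapp Y (vapp X h))). Qed.

Definition bracket (X Y : vfield) : vfield := MkVfield (bracket_smooth X Y).

End SmoothFunctions.

(* Tensor fields are families of tensors on the tangent spaces that send smooth
   vector fields to smooth functions, resp. vector fields. *)
Section Tensors.
Context {R : realType} {m : nat}.
Variable M : manifold R m.
Notation vf := (vfield M).

Record oneform := OneForm {
  form_at :> forall p : M, {scalar tangent p};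
  form_smooth : forall X : vf, smooth (fun p => form_at p (X p))
}.

Definition form_app (eta : oneform) (X : vf) : Cinf M :=
  toCinf (form_smooth eta X).

Record endo := Endo {
  endo_at :> forall p : M, {linear tangent p -> tangent p};
  endo_smooth : forall (X : vf) (h : Cinf M),
    smooth (fun p => endo_at p (X p) h)
}.

Definition endo_app (A : endo) (X : vf) : vf :=
  MkVfield (endo_smooth A X).

Lemma endo_sub_id_smooth (A : endo) (X : vf) (h : Cinf M) :
  smooth (fun p => (A p \- idfun) (X p) h).
Proof. exact: (CinfB_smooth (vapp (endo_app A X) h) (vapp X h)). Qed.

Definition endo_sub_id (A : endo) : endo :=
  Endo (endo_at := fun p => A p \- idfun : {linear tangent p -> tangent p})
    (endo_sub_id_smooth A).

Record metric := Metric {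
  met_at :> forall p : M, tangent p -> tangent p -> R;
  met_linear : forall (p : M) (a : R) (u v w : tangent p),
    met_at (a *: u + v) w = a * met_at u w + met_at v w;
  met_sym : forall (p : M) (u v : tangent p), met_at u v = met_at v u;
  met_pos : forall (p : M) (u : tangent p), u != 0 -> 0 < met_at u u;
  met_smooth : forall X Y : vf, smooth (fun p => met_at (X p) (Y p))
}.

Definition met_app (g : metric) (X Y : vf) : Cinf M :=
  toCinf (met_smooth g X Y).

Definition dform (eta : oneform) (X Y : vf) (p : M) : R :=
  2^-1 * (X p (form_app eta Y) - Y p (form_app eta X) - eta p (bracket X Y p)).

(* cov_at u Y is the covariant derivative of Y in the direction of the tangent
   vector u. *)
Record connection := Connection {
  cov_at : forall p : M, tangent p -> vf -> tangent p;
  cov_linear : forall (p : M) (a : R) (u v : tangent p) (Y : vf),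
    cov_at (a *: u + v) Y = a *: cov_at u Y + cov_at v Y;
  cov_add : forall (p : M) (u : tangent p) (Y Z : vf),
    cov_at u (vadd Y Z) = cov_at u Y + cov_at u Z;
  cov_leibniz : forall (p : M) (u : tangent p) (h : Cinf M) (Y : vf),
    cov_at u (vmul h Y) = u h *: Y p + h p *: cov_at u Y;
  cov_smooth : forall (X Y : vf) (h : Cinf M),
    smooth (fun p => cov_at (X p) Y h)
}.

Definition cov (nabla : connection) (X Y : vf) : vf :=
  MkVfield (cov_smooth nabla X Y).

Definition levi_civita (g : metric) (nabla : connection) : Prop :=
  (forall (X Y : vf) (p : M),
     cov nabla X Y p - cov nabla Y X p = bracket X Y p) /\
  (forall (X Y Z : vf) (p : M),
     X p (met_app g Y Z) =
     g p (cov nabla X Y p) (Z p) + g p (Y p) (cov nabla X Z p)).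

(* The Lie derivative of g along xi vanishes. *)
Definition killing (g : metric) (xi : vf) : Prop :=
  forall (X Y : vf) (p : M),
    xi p (met_app g X Y) =
    g p (bracket xi X p) (Y p) + g p (X p) (bracket xi Y p).

Definition curv (nabla : connection) (X Y Z : vf) (p : M) : tangent p :=
  cov nabla X (cov nabla Y Z) p - cov nabla Y (cov nabla X Z) p
  - cov nabla (bracket X Y) Z p.

(* (nabla_X A) Y at p *)
Definition cov_endo (nabla : connection) (A : endo) (X Y : vf) (p : M) :
    tangent p :=
  cov nabla X (endo_app A Y) p - A p (cov nabla X Y p).

(* A local frame near p is given by vector fields on M of which only the
   restrictions to a neighbourhood of p matter; by cutting off, every local
   frame agrees near p with one of this kind. *)
Definition local_frame (p : M) (e : 'I_m -> vf) : Prop :=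
  \forall q \near p, forall v : tangent q,
    exists! a : 'rV[R]_m, v = \sum_k a 0 k *: e k q.

Definition local_orthonormal_frame (g : metric) (p : M) (e : 'I_m -> vf) :
    Prop :=
  local_frame p e /\
  \forall q \near p, forall k l, g q (e k q) (e l q) = (k == l)%:R.

(* The trace at p of a C^oo(M)-linear map A from vector fields to vector
   fields, computed in any local frame. *)
Definition trace_at (p : M) (A : vf -> tangent p) : R :=
  xget 0 [set t : R | exists2 e : 'I_m -> vf, local_frame p e &
    exists2 a : 'M[R]_m,
      forall l, A (e l) = \sum_k a k l *: e k p & t = \tr a].

Definition ric (nabla : connection) (Y Z : vf) (p : M) : R :=
  trace_at (fun X => curv nabla X Y Z p).

Definition ric_sharp (g : metric) (nabla : connection) (X : vf) (p : M) :
    tangent p :=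
  xget 0 [set w : tangent p | forall Y : vf, g p w (Y p) = ric nabla X Y p].

Definition divergence (nabla : connection) (A : endo) (e : 'I_m -> vf) (p : M) :
    tangent p :=
  \sum_k cov_endo nabla A (e k) (e k) p.

End Tensors.

Section WeakStructures.
Context {R : realType} {m s : nat} {M : manifold R m}.
Variables (f Q : endo M) (xi : 'I_s -> vfield M) (eta : 'I_s -> oneform M).
Variable (g : metric M).

Definition in_D (p : M) (v : tangent p) : Prop := forall i, eta i p v = 0.

(* That D has rank m - s follows from eta^i(xi_j) = delta_ij. *)
Definition weak_metric_f_structure : Prop :=
  (forall p : M, bijective (Q p)) /\
  (forall (p : M) (v : tangent p),
     f p (f p v) = - Q p v + \sum_i eta i p v *: xi i p) /\
  (forall i j (p : M), eta i p (xi j p) = (i == j)%:R) /\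
  (forall i (p : M), Q p (xi i p) = xi i p) /\
  (forall (p : M) (v : tangent p), in_D v -> in_D (f p v)) /\
  (forall (p : M) (v w : tangent p),
     g p (f p v) (f p w) = g p v (Q p w) - \sum_i eta i p v * eta i p w).

Definition Phi (X Y : vfield M) (p : M) : R := g p (X p) (f p (Y p)).

Definition weak_f_contact : Prop :=
  weak_metric_f_structure /\
  forall i (X Y : vfield M) (p : M), Phi X Y p = dform (eta i) X Y p.

Definition weak_f_K_contact : Prop :=
  weak_f_contact /\ forall i, killing g (xi i).

Definition local_orthonormal_frame_D k (p : M) (e : 'I_k -> vfield M) : Prop :=
  \forall q \near p,
    [/\ forall l, in_D (e l q),
        forall l l', g q (e l q) (e l' q) = (l == l')%:R &
        forall v : tangent q, in_D v ->
          exists a : 'rV[R]_k, v = \sum_l a 0 l *: e l q].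

Definition trace_D k (A : endo M) (e : 'I_k -> vfield M) (p : M) : R :=
  \sum_l g p (A p (e l p)) (e l p).

End WeakStructures.

(* Main.v *)
Require Import Defs.
From HB Require Import structures.
From mathcomp Require Import all_boot all_order all_algebra.
From mathcomp Require Import ring lra.
From mathcomp Require Import all_classical all_reals all_analysis.
Import Order.TTheory GRing.Theory Num.Theory.
Import numFieldNormedType.Exports.

Set Implicit Arguments.
Unset Strict Implicit.
Unset Printing Implicit Defensive.

Local Open Scope classical_set_scope.
Local Open Scope ring_scope.

(* Skewness of [f] forces [f xi_i = 0], hence [eta^i = g(xi_i, _)], and then
   [Phi = d eta^i] together with the Killing equation gives
   [nabla_X xi_i = - f X].  The Lie derivative of [nabla] along a Killing field
   vanishes; writing [L_xi Y = nabla_xi Y + f Y], this is exactly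
   [R_{xi, X} Y = (nabla_X f) Y].  Taking [Y = xi_j] gives [R_{X, xi_i} xi_j].
   As maps of [X], both sides depend only on the value of [X] at the point, so
   that the traces reduce to a change of basis in one tangent space. *)

(** * Bases of a module and the trace of a linear map *)

Definition is_basis (R : pzRingType) (V : lmodType R) (m : nat)
    (e : 'I_m -> V) :=
  forall v, exists! a : 'rV[R]_m, v = \sum_k a 0 k *: e k.

Lemma is_basis_inj (R : pzRingType) (V : lmodType R) (m : nat) (e : 'I_m -> V)
  (x y : 'I_m -> R) :
  is_basis e -> \sum_k x k *: e k = \sum_k y k *: e k -> x =1 y.
Proof.
move=> be exy k; have [a [_ ua]] := be (\sum_k x k *: e k).
have Ex : a = \row_k x k by apply: ua; apply: eq_bigr => i _; rewrite mxE.
have Ey : a = \row_k y k.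
  by apply: ua; rewrite exy; apply: eq_bigr => i _; rewrite mxE.
by have := congr1 (fun b : 'rV_m => b 0 k) (etrans (esym Ex) Ey); rewrite !mxE.
Qed.

Lemma is_basis_coord {R : pzRingType} {V : lmodType R} {m : nat} {e : 'I_m -> V}
  (v : 'I_m -> V) : is_basis e ->
  exists b : 'M[R]_m, forall l, v l = \sum_k b k l *: e k.
Proof.
move=> be; have [b bP] := boolp.choice (fun l => be (v l)).
exists (\matrix_(k, l) b l 0 k) => l; rewrite {1}(bP l).1.
by apply: eq_bigr => k _; rewrite mxE.
Qed.

Lemma sum_mulmx_scale {R : comPzRingType} {V : lmodType R} {m : nat}
    {e v : 'I_m -> V} {b : 'M[R]_m} (a : 'M[R]_m) (l : 'I_m) :
  (forall k, v k = \sum_j b j k *: e j) ->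
  \sum_k a k l *: v k = \sum_j (b *m a) j l *: e j.
Proof.
move=> vE; under eq_bigr do rewrite vE scaler_sumr.
rewrite exchange_big /=; apply: eq_bigr => j _.
rewrite mxE scaler_suml; apply: eq_bigr => k _.
by rewrite scalerA mulrC.
Qed.

(** With [b] the matrix of [e'] in [e] and [c] that of [e] in [e'], one has [b c = 1], and
    [a b = b a'] since both sides hold the coordinates of the [L (e' l)] in [e]. Cyclicity of the
    trace concludes. *)
Lemma mxtrace_basis (R : comUnitRingType) (V : lmodType R) (m : nat)
    (e e' : 'I_m -> V) (L : {linear V -> V}) (a a' : 'M[R]_m) :
  is_basis e -> is_basis e' ->
  (forall l, L (e l) = \sum_k a k l *: e k) ->
  (forall l, L (e' l) = \sum_k a' k l *: e' k) -> \tr a = \tr a'.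
Proof.
move=> be be' Le Le'.
have [b bE] := is_basis_coord e' be; have [c cE] := is_basis_coord e be'.
have abE : a *m b = b *m a'.
  apply/matrixP => j l; apply: (is_basis_inj (x := fun j => (a *m b) j l)
    (y := fun j => (b *m a') j l) be) => //.
  rewrite -(sum_mulmx_scale b l Le) -(sum_mulmx_scale a' l bE) -Le' bE.
  by rewrite linear_sum; apply: eq_bigr => k _; rewrite linearZ.
have bc : b *m c = 1%:M.
  apply/matrixP => j l; apply: (is_basis_inj (x := fun j => (b *m c) j l)
    (y := fun j => (1%:M : 'M[R]_m) j l) be) => //.
  rewrite -(sum_mulmx_scale c l bE) -cE (bigD1 l) //= mxE eqxx scale1r.
  by rewrite big1 ?addr0 // => k /negPf kl; rewrite mxE kl scale0r.
by rewrite -[a]mulmx1 -bc mulmxA abE mxtrace_mulC mulmxA (mulmx1C bc) mul1mx.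
Qed.

(** * Tangent vectors and the Lie bracket *)

Section VectorFields.
Context {R : realType} {m : nat} {M : manifold R m}.
Implicit Types (X Y Z : vfield M) (h : Cinf M).

Lemma vfield_ext X Y : (forall p, X p = Y p) -> X = Y.
Proof.
case: X Y => [X Xs] [Y Ys] /= XY.
have E : X = Y by apply: functional_extensionality_dep.
by subst Y; rewrite (Prop_irrelevance Xs Ys).
Qed.

Lemma tangent_ext {p : M} (u v : tangent p) : (forall h, u h = v h) -> u = v.
Proof. by move=> uv; apply/val_inj/funext. Qed.

Lemma tappD {p : M} (u v : tangent p) h : (u + v) h = u h + v h.
Proof. by []. Qed.

Lemma tappN {p : M} (u : tangent p) h : (- u) h = - u h.
Proof. by []. Qed.

Lemma tangentD {p : M} (u : tangent p) h k : u (h + k) = u h + u k.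
Proof. by have [-> _ _] := tangent_derivation u. Qed.

Lemma tangentZ {p : M} (u : tangent p) (a : R) h : u (a *: h) = a * u h.
Proof. by have [_ -> _] := tangent_derivation u. Qed.

Lemma tangentN {p : M} (u : tangent p) h : u (- h) = - u h.
Proof. by rewrite -scaleN1r tangentZ mulN1r. Qed.

Lemma tangentB {p : M} (u : tangent p) h k : u (h - k) = u h - u k.
Proof. by rewrite tangentD tangentN. Qed.

Lemma tangent1 {p : M} (u : tangent p) : u 1 = 0.
Proof.
have [_ _ /(_ 1 1)] := tangent_derivation u.
rewrite mulr1 -[(1 : Cinf M) p]/1 mul1r => /eqP.
by rewrite eq_sym -subr_eq0 addrK => /eqP.
Qed.

(** Built from [vadd] and [vmul] so that [cov_add] and [cov_leibniz] apply to it. *)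
Definition vsub X Y : vfield M := vadd X (vmul (- 1) Y).

Lemma vsubE X Y p : vsub X Y p = X p - Y p.
Proof. by rewrite -[vsub X Y p]/(X p + (- 1) *: Y p) scaleN1r. Qed.

Lemma vapp_bracket X Y h :
  vapp (bracket X Y) h = vapp X (vapp Y h) - vapp Y (vapp X h).
Proof. exact/val_inj/funext. Qed.

Lemma vapp_add X Y h : vapp (vadd X Y) h = vapp X h + vapp Y h.
Proof. exact/val_inj/funext. Qed.

Lemma bracketE X Y p h : bracket X Y p h = X p (vapp Y h) - Y p (vapp X h).
Proof. by []. Qed.

Lemma bracketC X Y p : bracket X Y p = - bracket Y X p.
Proof.
by apply: tangent_ext => h; rewrite -[RHS]/(- (bracket Y X p h)) !bracketE opprB.
Qed.

Lemma bracket_addr X Y Z p :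
  bracket X (vadd Y Z) p = bracket X Y p + bracket X Z p.
Proof.
apply: tangent_ext => h.
rewrite -[RHS]/(bracket X Y p h + bracket X Z p h) !bracketE vapp_add tangentD.
by rewrite -[vadd Y Z p _]/(Y p _ + Z p _) opprD addrACA.
Qed.

Lemma bracket_jacobi X Y Z p :
  bracket X (bracket Y Z) p
  = bracket (bracket X Y) Z p + bracket Y (bracket X Z) p.
Proof.
apply: tangent_ext => h.
rewrite -[RHS]/(bracket (bracket X Y) Z p h + bracket Y (bracket X Z) p h).
by rewrite !(bracketE, vapp_bracket, tangentB); ring.
Qed.

End VectorFields.

(** * Bilinearity and nondegeneracy of the metric *)

Section Metrics.
Context {R : realType} {m : nat} {M : manifold R m}.
Variable g : metric M.
Implicit Types (X Y Z : vfield M) (p : M).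

Lemma metDl p (u v w : tangent p) : g p (u + v) w = g p u w + g p v w.
Proof. by rewrite -[u]scale1r met_linear mul1r scale1r. Qed.

Lemma met0l p (w : tangent p) : g p 0 w = 0.
Proof. by apply: (addrI (g p 0 w)); rewrite -metDl !addr0. Qed.

Lemma metZl p a (u w : tangent p) : g p (a *: u) w = a * g p u w.
Proof. by rewrite -[_ *: _]addr0 met_linear met0l addr0. Qed.

Lemma metNl p (u w : tangent p) : g p (- u) w = - g p u w.
Proof. by rewrite -scaleN1r metZl mulN1r. Qed.

Lemma metBl p (u v w : tangent p) : g p (u - v) w = g p u w - g p v w.
Proof. by rewrite metDl metNl. Qed.

Lemma metBr p (u v w : tangent p) : g p w (u - v) = g p w u - g p w v.
Proof. by rewrite !(met_sym _ w) metBl. Qed.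

Lemma metZr p a (u w : tangent p) : g p w (a *: u) = a * g p w u.
Proof. by rewrite !(met_sym _ w) metZl. Qed.

Lemma met0r p (w : tangent p) : g p w 0 = 0.
Proof. by rewrite met_sym met0l. Qed.

Lemma met_suml p (I : finType) (u : I -> tangent p) w :
  g p (\sum_i u i) w = \sum_i g p (u i) w.
Proof.
by apply: (big_morph (fun v => g p v w)) => [v v'|]; rewrite ?metDl ?met0l.
Qed.

Lemma met_sumr p (I : finType) (u : I -> tangent p) w :
  g p w (\sum_i u i) = \sum_i g p w (u i).
Proof. by rewrite met_sym met_suml; under eq_bigr do rewrite met_sym. Qed.

Lemma met_eq0 p (u : tangent p) : g p u u = 0 -> u = 0.
Proof. by move=> u0; apply/eqP/negPn/negP => /(met_pos g); rewrite u0 ltxx. Qed.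

(** The test vectors are values of global fields; the basis ensures that they span the tangent
    space, so [u - v] is orthogonal to itself. *)
Lemma basis_met_inj p (e : 'I_m -> vfield M) (u v : tangent p) :
  is_basis (fun k => e k p) -> (forall Y, g p u (Y p) = g p v (Y p)) -> u = v.
Proof.
move=> be uv; apply/subr0_eq/met_eq0.
have [a [uvE _]] := be (u - v); rewrite {2}uvE met_sumr big1 // => k _.
by rewrite metZr metBl uv subrr mulr0.
Qed.

End Metrics.

(** * Connections, curvature and the trace *)

Section Connections.
Context {R : realType} {m : nat} {M : manifold R m}.
Variable nabla : connection M.
Implicit Types (X Y Z : vfield M) (p : M).

Lemma cov_atD p (u v : tangent p) Y :
  cov_at nabla (u + v) Y = cov_at nabla u Y + cov_at nabla v Y.
Proof. by rewrite -[u]scale1r cov_linear !scale1r. Qed.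

Lemma cov_at0 p Y : cov_at nabla (0 : tangent p) Y = 0.
Proof.
by apply: (addrI (cov_at nabla (0 : tangent p) Y)); rewrite -cov_atD !addr0.
Qed.

Lemma cov_atZ p a (u : tangent p) Y :
  cov_at nabla (a *: u) Y = a *: cov_at nabla u Y.
Proof. by rewrite -[a *: u]addr0 cov_linear cov_at0 addr0. Qed.

Lemma cov_atN p (u : tangent p) Y : cov_at nabla (- u) Y = - cov_at nabla u Y.
Proof. by rewrite -scaleN1r cov_atZ scaleN1r. Qed.

Lemma cov_vsub p (u : tangent p) Y Z :
  cov_at nabla u (vsub Y Z) = cov_at nabla u Y - cov_at nabla u Z.
Proof.
rewrite cov_add cov_leibniz -[cfun (- 1) p]/(- 1) scaleN1r.
by rewrite tangentN tangent1 oppr0 scale0r add0r.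
Qed.

Lemma covE X Y p : cov nabla X Y p = cov_at nabla (X p) Y.
Proof. by []. Qed.

Lemma curvC X Y Z p : curv nabla X Y Z p = - curv nabla Y X Z p.
Proof.
rewrite /curv !covE (bracketC X Y) cov_atN !opprD !opprK.
by rewrite (addrC (- _)).
Qed.

(** [trace_at] picks a value realised by some frame. As [A X] depends linearly on [X p], all frames
    give the same value by [mxtrace_basis]; the given frame excludes the default case of [xget]. *)
Lemma trace_at_linear p (A : vfield M -> tangent p)
    (L : {linear tangent p -> tangent p}) (e : 'I_m -> vfield M) (a : 'M[R]_m) :
  (forall X, A X = L (X p)) -> local_frame p e ->
  (forall l, A (e l) = \sum_k a k l *: e k p) -> trace_at A = \tr a.
Proof.
move=> AL fe Ae; rewrite /trace_at.
case: xgetP => [t _ [e' fe' [a' Ae' ->]]|/(_ (\tr a)) []]; last first.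
  by exists e => //; exists a.
have be := nbhs_singleton fe; have be' := nbhs_singleton fe'.
by apply: (mxtrace_basis be' be (L := L)) => l; rewrite -AL ?Ae' ?Ae.
Qed.

End Connections.

(** * Killing fields and the invariance of the Levi-Civita connection *)

Section Killing.
Context {R : realType} {m : nat} {M : manifold R m}.
Variables (g : metric M) (nabla : connection M).
Hypothesis LC : levi_civita g nabla.
Implicit Types (X Y Z : vfield M) (p : M).

Lemma torsion_free X Y p : cov nabla X Y p - cov nabla Y X p = bracket X Y p.
Proof. exact: LC.1. Qed.

Lemma met_compatible X Y Z p : X p (met_app g Y Z) =
  g p (cov nabla X Y p) (Z p) + g p (Y p) (cov nabla X Z p).
Proof. exact: LC.2. Qed.

Lemma vapp_met_compatible X Y Z : vapp X (met_app g Y Z) =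
  met_app g (cov nabla X Y) Z + met_app g Y (cov nabla X Z).
Proof. by apply/val_inj/funext => p; exact: met_compatible. Qed.

Section KillingField.
Variable xi : vfield M.
Hypothesis kxi : killing g xi.

(** Once brackets are written through [nabla], metric compatibility cancels the terms differentiated
    along [xi] in the Killing equation. *)
Lemma killing_cov_skew X Y p :
  g p (cov nabla X xi p) (Y p) = - g p (X p) (cov nabla Y xi p).
Proof.
have := kxi X Y p; rewrite met_compatible -!torsion_free metBl metBr.
by move/(congr1 (fun t => t - g p (cov nabla xi X p) (Y p)
  - g p (X p) (cov nabla xi Y p))); lra.
Qed.

Lemma vapp_killing X Y : vapp xi (met_app g X Y) =
  met_app g (bracket xi X) Y + met_app g X (bracket xi Y).
Proof. by apply/val_inj/funext => p; exact: kxi. Qed.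

(* The value at (X, Y) of the Lie derivative of nabla along xi. *)
Definition lie_cov X Y : vfield M :=
  vsub (vsub (bracket xi (cov nabla X Y)) (cov nabla X (bracket xi Y)))
    (cov nabla (bracket xi X) Y).

Lemma lie_covE X Y p : lie_cov X Y p =
  bracket xi (cov nabla X Y) p - cov nabla X (bracket xi Y) p
  - cov nabla (bracket xi X) Y p.
Proof. by rewrite !vsubE. Qed.

(** The antisymmetric part is the Lie derivative of the torsion, hence zero; the Jacobi identity
    supplies the Lie derivative of [bracket X Y]. *)
Lemma lie_cov_sym X Y p : lie_cov X Y p = lie_cov Y X p.
Proof.
have XY : cov nabla X Y = vadd (bracket X Y) (cov nabla Y X).
  apply: vfield_ext => q.
  by rewrite -[RHS]/(bracket X Y q + _) -torsion_free subrK.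
rewrite !lie_covE XY bracket_addr bracket_jacobi -!torsion_free.
by apply: tangent_ext => h; rewrite !(tappD, tappN); ring.
Qed.

(** The derivative of [g(Y, Z)] along [bracket xi X] is computed twice: by metric compatibility, and
    as a commutator in which [xi] acts through brackets (Killing) and [X] through [nabla]. *)
Lemma lie_cov_skew X Y Z p :
  g p (lie_cov X Y p) (Z p) + g p (Y p) (lie_cov X Z p) = 0.
Proof.
have /eqP := bracketE xi X p (met_app g Y Z).
rewrite vapp_met_compatible vapp_killing !tangentD !kxi !met_compatible.
by rewrite !lie_covE !metBl !metBr => /eqP; lra.
Qed.

(* A trilinear form symmetric in its first two arguments and skew in its last
   two vanishes. *)
Lemma lie_cov_eq0 X Y p : lie_cov X Y p = 0.
Proof.
apply: (met_eq0 (g := g)).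
set Z := lie_cov X Y; rewrite -[lie_cov X Y p]/(Z p).
have t X' Y' Z' : g p (lie_cov X' Y' p) (Z' p) = - g p (lie_cov X' Z' p) (Y' p).
  by apply/eqP; rewrite -addr_eq0 (met_sym _ (lie_cov X' Z' p)) lie_cov_skew.
(* Symmetry in the first two slots links these relations into a cycle that returns the squared norm
   of [Z] at [p] with the opposite sign. *)
have E1 := t X Y Z; have E2 := t Z X Y; have E3 := t Y Z X.
rewrite (lie_cov_sym X Z) in E1; rewrite (lie_cov_sym Z Y) in E2.
by rewrite (lie_cov_sym Y X) in E3; move: E1 E2 E3; rewrite -/Z; lra.
Qed.

(** Substituting [bracket xi Z - A Z] for the derivative of [Z] along [xi] turns the curvature into
    [lie_cov], which vanishes, plus the covariant derivative of [A]. *)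
Lemma killing_curv (A : endo M) :
  (forall X p, cov nabla X xi p = - A p (X p)) ->
  forall X Y p, curv nabla xi X Y p = cov_endo nabla A X Y p.
Proof.
move=> Axi X Y p.
have covxi Z q : cov nabla xi Z q = bracket xi Z q - A q (Z q).
  by rewrite -torsion_free Axi opprK addrK.
have covxiY : cov nabla xi Y = vsub (bracket xi Y) (endo_app A Y).
  by apply: vfield_ext => q; rewrite vsubE covxi.
rewrite /curv covxi covxiY (covE _ X (vsub _ _)) cov_vsub -!covE /cov_endo.
apply/subr0_eq; rewrite -(lie_cov_eq0 X Y p) lie_covE.
by apply: tangent_ext => h; rewrite !(tappD, tappN); ring.
Qed.

End KillingField.
End Killing.

(** * Identities of weak f-contact and weak f-K-contact structures *)

Section WeakFContact.
Context {R : realType} {m s : nat} {M : manifold R m}.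
Variables (f Q : endo M) (xi : 'I_s -> vfield M) (eta : 'I_s -> oneform M).
Variable g : metric M.
Hypothesis fC : weak_f_contact f Q xi eta g.
Implicit Types (X Y Z : vfield M) (p : M).

Lemma f2E p (v : tangent p) : f p (f p v) = - Q p v + \sum_i eta i p v *: xi i p.
Proof. by have [[_ [-> _]] _] := fC. Qed.

Lemma eta_xi i j p : eta i p (xi j p) = (i == j)%:R.
Proof. by have [[_ [_ [-> _]]] _] := fC. Qed.

Lemma sum_eta_xi p (i : 'I_s) (F : 'I_s -> tangent p) :
  \sum_j eta j p (xi i p) *: F j = F i.
Proof.
rewrite (bigD1 i) //= eta_xi eqxx scale1r big1 ?addr0 // => j /negPf ji.
by rewrite eta_xi ji scale0r.
Qed.

Lemma Q_xi i p : Q p (xi i p) = xi i p.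
Proof. by have [[_ [_ [_ [-> _]]]] _] := fC. Qed.

Lemma f2_in_D p (v : tangent p) : in_D eta v -> f p (f p v) = - Q p v.
Proof. by move=> v0; rewrite f2E big1 ?addr0 // => i _; rewrite v0 scale0r. Qed.

Lemma f_in_D p (v : tangent p) : in_D eta v -> in_D eta (f p v).
Proof. by have [[_ [_ [_ [_ [+ _]]]]] _] := fC; apply. Qed.

Lemma met_f p (v w : tangent p) :
  g p (f p v) (f p w) = g p v (Q p w) - \sum_i eta i p v * eta i p w.
Proof. by have [[_ [_ [_ [_ [_ ->]]]]] _] := fC. Qed.

(** [Phi] is an exterior derivative, hence antisymmetric; the index [i] supplies the 1-form. *)
Lemma f_skew (i : 'I_s) X Y p : g p (X p) (f p (Y p)) = - g p (f p (X p)) (Y p).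
Proof.
have [_ c] := fC; have := c i X Y p; have := c i Y X p.
rewrite /Phi /dform (bracketC Y X) raddfN (met_sym _ (f p (X p))) => -> ->.
by lra.
Qed.

(** By skewness the squared norm of [f xi_i] is [-g(f^2 xi_i, xi_i)], and
    [f^2 xi_i = -Q xi_i + xi_i = 0]. *)
Lemma f_xi i p : f p (xi i p) = 0.
Proof.
apply: (met_eq0 (g := g)).
rewrite -[X in g p _ X]/(endo_app f (xi i) p) met_sym.
rewrite (f_skew i) -[endo_app f (xi i) p]/(f p (xi i p)).
by rewrite f2E Q_xi sum_eta_xi addNr met0l oppr0.
Qed.

(** This is [met_f] at [w = xi_i], where the left side vanishes by [f_xi]. *)
Lemma etaE i p (v : tangent p) : eta i p v = g p (xi i p) v.
Proof.
have := met_f v (xi i p); rewrite f_xi met0r Q_xi (bigD1 i) //= eta_xi eqxx mulr1.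
rewrite big1 => [|j /negPf ji]; last by rewrite eta_xi ji mulr0.
by rewrite addr0 met_sym => /esym/eqP; rewrite subr_eq0 => /eqP.
Qed.

Lemma form_appE i X : form_app (eta i) X = met_app g (xi i) X.
Proof. by apply/val_inj/funext => p; exact: etaE. Qed.

Variable nabla : connection M.
Hypothesis LC : levi_civita g nabla.
Hypothesis kxi : forall i, killing g (xi i).

(** By the Killing property, [d eta^i(X, W)] with its factor 1/2 is [g(nabla_X xi_i, W)]. It equals
    [Phi(X, W) = -g(f X, W)], so the choice [W = nabla_X xi_i + f X] has norm zero at [p]. *)
Lemma cov_xi i X p : cov nabla X (xi i) p = - f p (X p).
Proof.
pose W := vadd (cov nabla X (xi i)) (endo_app f X).
have WE q : W q = cov nabla X (xi i) q + f q (X q) by [].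
apply/eqP; rewrite -addr_eq0 -WE; apply/eqP/(met_eq0 (g := g)).
rewrite {1}WE metDl.
have [_ /(_ i X W p)] := fC; rewrite /Phi /dform !(form_appE, etaE).
rewrite !(met_compatible LC) -(torsion_free LC) metBr (f_skew i).
have := killing_cov_skew LC (kxi i) X W p; rewrite (met_sym _ (X p)).
by lra.
Qed.

Lemma curv_xil i X Y p : curv nabla (xi i) X Y p = cov_endo nabla f X Y p.
Proof. by apply: (killing_curv LC (kxi i)) => Z q; rewrite cov_xi. Qed.

Lemma curv_xir i X Y p :
  curv nabla X (xi i) Y p = - cov_endo nabla f X Y p.
Proof. by rewrite curvC curv_xil. Qed.

Lemma curv_xi i j X p : curv nabla X (xi i) (xi j) p = - f p (f p (X p)).
Proof.
rewrite curv_xir /cov_endo.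
(* The field [f xi_j] is zero; as a difference of equal fields it is differentiated by
   [cov_vsub]. *)
have -> : endo_app f (xi j) = vsub (xi j) (xi j).
  by apply: vfield_ext => q; rewrite vsubE subrr; exact: f_xi.
by rewrite covE cov_vsub subrr sub0r opprK cov_xi linearN.
Qed.

(** Obtained by differentiating [g(f Y, Z) = -g(Y, f Z)] along [X]. *)
Lemma cov_f_skew (i : 'I_s) X Y Z p :
  g p (cov_endo nabla f X Y p) (Z p) = - g p (Y p) (cov_endo nabla f X Z p).
Proof.
have E : met_app g (endo_app f Y) Z = - met_app g Y (endo_app f Z).
  apply/val_inj/funext => q.
  rewrite -[LHS]/(g q (f q (Y q)) (Z q)) -[RHS]/(- g q (Y q) (f q (Z q))).
  by rewrite (f_skew i) opprK.
have := congr1 (X p) E; rewrite tangentN !(met_compatible LC) /cov_endo.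
rewrite metBl metBr (f_skew i _ (cov nabla X Z)).
have := f_skew i (cov nabla X Y) Z p.
rewrite -[endo_app f Y p]/(f p (Y p)) -[endo_app f Z p]/(f p (Z p)); lra.
Qed.

(** The map [X |-> R_{X, xi_i} Y = -(nabla_X f) Y] on tangent vectors, the form that
    [trace_at_linear] requires. *)
Definition cov_f_linear Y p (v : tangent p) : tangent p :=
  f p (cov_at nabla v Y) - cov_at nabla v (endo_app f Y).

Lemma cov_f_linear_subproof Y p : linear (@cov_f_linear Y p).
Proof.
move=> a u v; rewrite /cov_f_linear !cov_linear linearP scalerBr.
by rewrite opprD addrACA.
Qed.

HB.instance Definition _ Y p :=
  GRing.isLinear.Build R (tangent p) (tangent p) *:%R (@cov_f_linear Y p)
    (@cov_f_linear_subproof Y p).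

(** In an orthonormal frame the trace is the sum of the [-g((nabla_{e_k} f) Y, e_k)]; [cov_f_skew]
    turns each term into [g(Y, (nabla_{e_k} f) e_k)]. *)
Lemma ric_xi i p (e : 'I_m -> vfield M) Y :
  local_orthonormal_frame g p e ->
  ric nabla (xi i) Y p = g p (divergence nabla f e p) (Y p).
Proof.
move=> [fe /nbhs_singleton oe].
pose A := fun X => curv nabla X (xi i) Y p.
have AE X : A X = @cov_f_linear Y p (X p).
  by rewrite /A curv_xir /cov_endo opprB.
have [a aE] := is_basis_coord (fun l => A (e l)) (nbhs_singleton fe).
rewrite /ric (trace_at_linear AE fe aE) /mxtrace /divergence met_suml.
apply: eq_bigr => k _.
have -> : a k k = g p (A (e k)) (e k p).
  rewrite aE met_suml (bigD1 k) //= metZl oe eqxx mulr1 big1 ?addr0 // => j jk.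
  by rewrite metZl oe (negPf jk) mulr0.
by rewrite /A curv_xir metNl (cov_f_skew i) opprK met_sym.
Qed.

(** The divergence is a candidate for [xget] by [ric_xi], and the frame makes the candidate
    unique. *)
Lemma ric_sharp_xi i p (e : 'I_m -> vfield M) :
  local_orthonormal_frame g p e ->
  ric_sharp g nabla (xi i) p = divergence nabla f e p.
Proof.
move=> oe; have E Y := ric_xi i Y oe; rewrite /ric_sharp.
case: xgetP => [w _ /= wE|/(_ (divergence nabla f e p))[] Y]; last by rewrite E.
by apply: (basis_met_inj (g := g) (nbhs_singleton oe.1)) => Y; rewrite wE E.
Qed.

End WeakFContact.

(** * Frames adapted to D and the trace of Q *)

Section FullFrame.
Context {R : realType} {k s : nat} {M : manifold R (k + s)}.
Variables (f Q : endo M) (xi : 'I_s -> vfield M) (eta : 'I_s -> oneform M).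
Variable g : metric M.
Hypothesis fC : weak_f_contact f Q xi eta g.
Variables (p : M) (e : 'I_k -> vfield M).
Hypothesis oe : local_orthonormal_frame_D eta g p e.

Definition full_frame (l : 'I_(k + s)) : vfield M :=
  match fintype.split l with inl i => e i | inr j => xi j end.

Lemma full_frame_l i : full_frame (lshift s i) = e i.
Proof. by rewrite /full_frame (unsplitK (inl i)). Qed.

Lemma full_frame_r j : full_frame (rshift k j) = xi j.
Proof. by rewrite /full_frame (unsplitK (inr j)). Qed.

Lemma full_frame_sum q (a : 'I_(k + s) -> R) :
  \sum_l a l *: full_frame l q =
  \sum_i a (lshift s i) *: e i q + \sum_j a (rshift k j) *: xi j q.
Proof.
rewrite big_split_ord; congr (_ + _); apply: eq_bigr => i _.
  by rewrite full_frame_l.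
by rewrite full_frame_r.
Qed.

(** Removing the [xi_j] components of [v], given by the [eta^j], leaves a vector of D, which expands
    in [e]. For uniqueness, [eta^j] reads off the coefficient of [xi_j], and then inner products
    with the [e_l] give the others. *)
Lemma full_frame_local : local_frame p full_frame.
Proof.
apply: filterS oe => q [eD eo egen] v.
have eta_e (b : 'I_k -> R) i : eta i q (\sum_l b l *: e l q) = 0.
  by rewrite linear_sum big1 // => l _; rewrite linearZ /= eD mulr0.
have eta_sum (b : 'I_s -> R) i : eta i q (\sum_j b j *: xi j q) = b i.
  rewrite linear_sum (bigD1 i) //= linearZ /= (eta_xi fC) eqxx mulr1.
  rewrite big1 ?addr0 // => j /negPf ji.
  by rewrite linearZ /= (eta_xi fC) eq_sym ji mulr0.
pose w := v - \sum_j eta j q v *: xi j q.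
have [i|b wE] := egen w.
  by rewrite linearB /= eta_sum subrr.
exists (row_mx b (\row_j eta j q v)); split.
  rewrite full_frame_sum.
  under eq_bigr do rewrite row_mxEl.
  rewrite -wE; under [X in _ + X]eq_bigr do rewrite row_mxEr mxE.
  by rewrite subrK.
move=> c vE; rewrite -[c]hsubmxK.
have cE := full_frame_sum q (fun l => c 0 l); rewrite -vE in cE.
have c2 j : c 0 (rshift k j) = eta j q v.
  by rewrite cE linearD /= eta_e add0r eta_sum.
congr row_mx; apply/rowP => l; last by rewrite !mxE c2.
have : w = \sum_i c 0 (lshift s i) *: e i q.
  rewrite /w {1}cE -addrA; under [X in _ + (X - _)]eq_bigr do rewrite c2.
  by rewrite subrr addr0.
have met_e (d : 'I_k -> R) : g q (\sum_i d i *: e i q) (e l q) = d l.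
  rewrite met_suml (bigD1 l) //= metZl eo eqxx mulr1 big1 ?addr0 // => j jl.
  by rewrite metZl eo (negPf jl) mulr0.
by rewrite wE => /(congr1 (fun u => g q u (e l q))); rewrite !met_e mxE => ->.
Qed.

(** [-f^2] is [Q] on D and zero on each [xi_j], so its matrix in the full frame has a single nonzero
    block. *)
Lemma trace_at_neg_f2 (A : vfield M -> tangent p) :
  (forall X, A X = - f p (f p (X p))) -> trace_at A = trace_D g Q e p.
Proof.
move=> AE; have [eD eo egen] := nbhs_singleton oe.
(* [Q] preserves D, since [-Q = f^2] there and [f] preserves D. *)
have QE l : Q p (e l p) = \sum_i g p (Q p (e l p)) (e i p) *: e i p.
  have [|b bE] := egen (Q p (e l p)).
    have := f_in_D fC (f_in_D fC (eD l)); rewrite (f2_in_D fC (eD l)) => h i.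
    by have /eqP := h i; rewrite linearN oppr_eq0 => /eqP.
  rewrite {1}bE; apply: eq_bigr => i _; congr (_ *: _).
  rewrite bE met_suml (bigD1 i) //= metZl eo eqxx mulr1 big1 ?addr0 // => j ji.
  by rewrite metZl eo (negPf ji) mulr0.
pose a := block_mx (\matrix_(i, l) g p (Q p (e l p)) (e i p)) 0 0 0
  : 'M[R]_(k + s).
have AL X : A X = (- (f p \o f p) : {linear tangent p -> tangent p}) (X p).
  by rewrite AE.
rewrite (trace_at_linear (a := a) AL full_frame_local); last first.
  move=> l; rewrite AE (full_frame_sum p (fun j => a j l)).
  case: (split_ordP l) => j ->; rewrite ?full_frame_l ?full_frame_r.
    rewrite (f2_in_D fC (eD j)) opprK {1}QE [X in _ + X]big1 ?addr0.
      by apply: eq_bigr => i _; rewrite block_mxEul mxE.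
    by move=> i _; rewrite block_mxEdl mxE scale0r.
  rewrite (f_xi fC) linear0 oppr0 !big1 ?addr0 // => i _.
    by rewrite block_mxEdr mxE scale0r.
  by rewrite block_mxEur mxE scale0r.
rewrite mxtrace_block mxtrace0 addr0; apply: eq_bigr => i _.
by rewrite mxE.
Qed.

Lemma trace_D_sub_id :
  trace_D g Q e p = k%:R + trace_D g (endo_sub_id Q) e p.
Proof.
have [_ eo _] := nbhs_singleton oe.
rewrite /trace_D -[k in k%:R]card_ord -sumr_const -big_split /=.
by apply: eq_bigr => i _; rewrite metBl eo eqxx addrC subrK.
Qed.

End FullFrame.

Unset Implicit Arguments.

Theorem proposition5p1 (R : realType) (n s : nat) (n1 : (1 <= n)%N)
  (s1 : (1 <= s)%N) (M : manifold R (2 * n + s)) (f Q : endo M)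
  (xi : 'I_s -> vfield M) (eta : 'I_s -> oneform M) (g : metric M)
  (fK : weak_f_K_contact f Q xi eta g)
  (nabla : connection M) (LC : levi_civita g nabla) :
  [/\ (forall (i : 'I_s) (X Y : vfield M) (p : M),
         curv nabla (xi i) X Y p = cov_endo nabla f X Y p),
      (forall (i j : 'I_s) (X : vfield M) (p : M),
         curv nabla X (xi i) (xi j) p = - f p (f p (X p))),
      (forall (i : 'I_s) (p : M) (e : 'I_(2 * n + s)%N -> vfield M),
         local_orthonormal_frame g p e ->
         ric_sharp g nabla (xi i) p = divergence nabla f e p) &
      (forall (i j : 'I_s) (p : M) (e : 'I_(2 * n)%N -> vfield M),
         local_orthonormal_frame_D eta g p e ->
         ric nabla (xi i) (xi j) p = trace_D g Q e p /\
         trace_D g Q e p = (2 * n)%N%:R + trace_D g (endo_sub_id Q) e p)].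
Proof.
have [fC kxi] := fK; split=> [i X Y p|i j X p|i p e oe|i j p e oe].
- exact: (curv_xil fC LC kxi i).
- exact: (curv_xi fC LC kxi i j).
- exact: (ric_sharp_xi fC LC kxi i oe).
- split; last exact: (trace_D_sub_id Q oe).
  (* [Ric(xi_i, xi_j)] is the trace of [X |-> R_{X, xi_i} xi_j = -f^2 X]. *)
  by apply: (trace_at_neg_f2 fC oe) => X; exact: (curv_xi fC LC kxi i j).
Qed.
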